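(* Let $X$ be a subspace of the Cantor set $2^\omega$. Assume that $X$ is h-homogeneously embedded in $2^\omega$ and that $X$ is countably controlled. Then $X$ is countable dense homogeneous.
   Context: Space means separable metrizable topological space; countable means at most countable. A $\pi$-base for a space $Z$ is a collection $\mathcal{B}$ of non-empty open subsets of $Z$ such that for every non-empty open subset $U$ of $Z$ there exists $V\in\mathcal{B}$ with $V\subseteq U$. A subspace $X$ of a space $Z$ is h-homogeneously embedded in $Z$ if there exist a $\pi$-base $\mathcal{B}$ for $Z$ consisting of clopen sets and homeomorphisms $\varphi_U:Z\to U$ for $U\in\mathcal{B}$ such that $\varphi_U[X]=X\cap U$ for every $U\in\mathcal{B}$. A space is Polish if it admits a complete metric (compatible with its topology). A space $X$ is countably controlled if for every countable $D\subseteq X$ there exists a Polish subspace $G$ of $X$ such that $D\subseteq G\subseteq X$. A space $X$ is countable dense homogeneous if for every pair $(A,B)$ of countable dense subsets of $X$ there exists a homeomorphism $h:X\to X$ such that $h[A]=B$. *)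

(* Defs.v *)
From HB Require Import structures.
From mathcomp Require Import all_boot all_order all_algebra.
From mathcomp Require Import all_classical all_reals all_analysis.
Set Implicit Arguments.
Unset Strict Implicit.
Unset Printing Implicit Defensive.
Import Order.TTheory GRing.Theory Num.Theory.

Local Open Scope classical_set_scope.
Local Open Scope ring_scope.

(* The definitions below are about whole topological spaces; a subspace is the
   type [set_type X] of a set [X] (inserted by the coercion from sets to types)
   with the initial topology of [set_val]. *)

Definition homeomorphism (S T : topologicalType) (f : S -> T) : Prop :=
  exists g : T -> S,
    [/\ cancel f g, cancel g f, continuous f & continuous g].

Definition separable_space (T : topologicalType) : Prop :=
  exists D : set T, countable D /\ dense D.

Definition is_metric (R : realType) (T : Type) (d : T -> T -> R) : Prop :=
  [/\ forall x y, 0 <= d x y,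
      forall x y, d x y = 0 <-> x = y,
      forall x y, d x y = d y x &
      forall x y z, d x z <= d x y + d y z].

Definition metric_compatible (R : realType) (T : topologicalType)
    (d : T -> T -> R) : Prop :=
  forall (x : T) (A : set T),
    nbhs x A <-> exists2 e : R, 0 < e & [set y | d x y < e] `<=` A.

Definition cauchy_seq (R : realType) (T : Type) (d : T -> T -> R)
    (u : nat -> T) : Prop :=
  forall e : R, 0 < e ->
    exists N : nat, forall m n : nat,
      (N <= m)%N -> (N <= n)%N -> d (u m) (u n) < e.

Definition complete_metric (R : realType) (T : topologicalType)
    (d : T -> T -> R) : Prop :=
  forall u : nat -> T, cauchy_seq d u -> exists l : T, u @ \oo --> l.

(* Separability is part of the definition because "space" stands for
   "separable metrizable space". *)
Definition polish (R : realType) (T : topologicalType) : Prop :=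
  separable_space T /\
  exists d : T -> T -> R,
    [/\ is_metric d, metric_compatible d & complete_metric d].

Definition pi_base (Z : topologicalType) (B : set (set Z)) : Prop :=
  (forall V, B V -> open V /\ V !=set0) /\
  (forall U, open U -> U !=set0 -> exists2 V, B V & V `<=` U).

Definition h_homogeneously_embedded (Z : topologicalType) (X : set Z) : Prop :=
  exists B : set (set Z),
    [/\ pi_base B,
        forall U, B U -> clopen U &
        forall U, B U ->
          exists phi : Z -> U,
            homeomorphism phi /\ [set set_val (phi x) | x in X] = X `&` U].

Definition countably_controlled (R : realType) (T : topologicalType) : Prop :=
  forall D : set T, countable D -> exists G : set T, polish R G /\ D `<=` G.

Definition countable_dense_homogeneous (T : topologicalType) : Prop :=
  forall A B : set T,
    countable A -> dense A -> countable B -> dense B ->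
    exists h : T -> T, homeomorphism h /\ h @` A = B.

(* Main.v *)
(** Let [A] and [B] be countable dense in [X], let [D] be a countable subset of
    [X] containing both and closed under countably many of the given embeddings
    of the Cantor set and their inverses, and choose a Polish [G] between [D]
    and [X].  The complement of [G] is an increasing union of closed sets [K n]
    missing [D].  Zigzagging between two sequences of clopen sets converging to
    points [p] and [b] of [D] yields an involution of the Cantor set, supported
    near [p] and [b], that exchanges them and preserves both [X] and [D].
    Composing such involutions, one matches [A] with [B] point by point; since
    [D] is preserved and misses [K n], the [n]-th correction can be supported
    away from [K n], in the domain and in the range.  The limit [h] then agrees
    on [K n], and its inverse too, with a map preserving [X]; as every point
    outside [X] lies in some [K n], [h] preserves [X]. *)

Require Import Defs.
From mathcomp Require Import all_boot all_order all_algebra.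
From mathcomp Require Import all_classical all_reals all_analysis.
From mathcomp Require Import zify.
Set Implicit Arguments.
Unset Strict Implicit.
Unset Printing Implicit Defensive.
Import Order.TTheory GRing.Theory Num.Theory.

Local Open Scope classical_set_scope.

Local Notation C := cantor_space.

(** * The topology of the Cantor set through agreement of initial segments *)

Definition agree (n : nat) (x y : C) : Prop := forall i, (i < n)%N -> x i = y i.

Lemma agree_refl n x : agree n x x. Proof. by []. Qed.

#[local] Hint Resolve agree_refl : core.

Lemma agree_sym n x y : agree n x y -> agree n y x.
Proof. by move=> xy i /xy. Qed.

Lemma agree_trans n y x z : agree n x y -> agree n y z -> agree n x z.
Proof. by move=> xy yz i lin; rewrite xy ?yz. Qed.

Lemma agree_le m n x y : (m <= n)%N -> agree n x y -> agree m x y.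
Proof. by move=> mn xy i im; apply: xy; exact: leq_trans mn. Qed.

Lemma agree_eq (x y : C) : (forall n, agree n x y) -> x = y.
Proof. by move=> xy; apply: functional_extensionality_dep => i; exact: (xy i.+1). Qed.

Lemma agree_neq (x y : C) : x <> y -> exists n, ~ agree n x y.
Proof. by move=> xy; apply/existsNP => h; apply: xy; exact: agree_eq. Qed.

Lemma agreeSP n x y : agree n.+1 x y <-> agree n x y /\ x n = y n.
Proof.
split=> [xy|[xy xyn] i]; first by split; [exact: agree_le xy|exact: xy].
by rewrite ltnS leq_eqVlt => /predU1P[->|/xy].
Qed.

Lemma nbhs_coordinate (x : C) i : nbhs x [set y : C | y i = x i].
Proof.
have : {for x, continuous (proj i : C -> bool)} by exact: proj_continuous.
by move=> /(_ [set x i]); apply; exact: discrete_set1.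
Qed.

Lemma nbhs_agree (x : C) n : nbhs x (agree n x).
Proof.
elim: n => [|n IHn]; first exact: filterS filterT.
apply: filterS (filterI IHn (nbhs_coordinate x n)) => y [xy yn].
by apply/agreeSP; split => //; rewrite yn.
Qed.

Lemma nbhs_agreeP (x : C) (A : set C) :
  nbhs x A <-> exists n, agree n x `<=` A.
Proof.
split=> [|[n]]; last by move=> /filterS; apply; exact: nbhs_agree.
pose F := filter_from [set: nat] (agree^~ x).
have FF : Filter F.
  apply: filter_from_filter; first by exists 0%N.
  move=> i j _ _; exists (maxn i j) => // y xy.
  by split; apply: agree_le xy; rewrite ?leq_maxl ?leq_maxr.
(* The product topology is a supremum of coordinate topologies, so convergence of the cylinder
   filter can be tested one coordinate at a time. *)
suff : F --> (x : prod_topology (fun _ : nat => bool)).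
  by move=> /(_ A) cF /cF[n _ nA]; exists n.
apply/cvg_sup => i B [W [[V oV <-] Vx WB]].
by exists i.+1 => // y xy; apply: WB; rewrite /= -(xy i).
Qed.

Lemma open_agreeP (A : set C) :
  open A <-> forall x, A x -> exists n, agree n x `<=` A.
Proof. by rewrite openE; split=> h x /h /nbhs_agreeP. Qed.

Lemma continuous_agreeP (f : C -> C) (x : C) : {for x, continuous f} <->
  forall n, exists m, forall y, agree m x y -> agree n (f x) (f y).
Proof.
split=> [cf n|cf A].
  by have /nbhs_agreeP[m] := cf _ (nbhs_agree (f x) n); exists m.
move=> /nbhs_agreeP[n nA]; have [m mn] := cf n.
by apply/nbhs_agreeP; exists m => y /mn/nA.
Qed.

Lemma clopen_agree n x : clopen (agree n x).
Proof.
split; first by apply/open_agreeP => y xy; exists n => z; exact: agree_trans.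
rewrite -openC; apply/open_agreeP => y xy; exists n => z yz xz.
by apply: xy; apply: agree_trans xz _; exact: agree_sym.
Qed.

(** * Shrinking the Cantor set into its open subsets *)

Definition clopen_copy (V : set C) (phi psi : C -> C) : Prop :=
  [/\ continuous phi, continuous psi, cancel phi psi, clopen (range phi) &
      range phi `<=` V].

Lemma clopenD (T : topologicalType) (A B : set T) :
  clopen A -> clopen B -> clopen (A `\` B).
Proof. by move=> cA cB; apply: clopenI => //; exact: (clopenC setT). Qed.

(** One embedding serves all sets of the family at once; the family used in the end consists of [X]
    and a countable [D]. *)
Definition shrinkable (Ss : set (set C)) : Prop :=
  forall V : set C, open V -> V !=set0 -> exists phi psi,
    clopen_copy V phi psi /\ forall S, Ss S -> phi @^-1` S = S.

(** * An involution exchanging two points *)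

Section swap.
Variables (p b : C) (m : nat).
Hypothesis pb : ~ agree m p b.

Let center (e : bool) : C := if e then b else p.

(* The pieces with even index shrink to [p], those with odd index to [b]. *)
Let piece (k : nat) : set C :=
  agree (m + k./2) (center (odd k)) `\` agree (m + k./2).+1 (center (odd k)).

Let center_sep d e z : agree m (center d) z -> agree m (center e) z -> d = e.
Proof.
move=> dz ez; have := agree_trans dz (agree_sym ez).
by case: d e {dz ez} => [] [] //= h; exfalso; apply: pb => //; exact: agree_sym.
Qed.

Let piece_center k z : piece k z -> agree m (center (odd k)) z.
Proof. by case=> h _; apply: agree_le h; rewrite leq_addr. Qed.

Let clopen_piece k : clopen (piece k).
Proof. by apply: clopenD; exact: clopen_agree. Qed.

Let piece_neq0 k : piece k !=set0.
Proof.
set n := (m + k./2)%N; set c := center (odd k).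
exists (fun i => if i == n then ~~ c n else c i); split=> [i /ltn_eqF/= ->//|].
by move=> /(_ n (ltnSn _)); rewrite eqxx -/c; case: (c n).
Qed.

Let piece_disjoint j k z : piece j z -> piece k z -> j = k.
Proof.
move=> jz kz; have jk := center_sep (piece_center jz) (piece_center kz).
have le i i' : odd i = odd i' -> piece i z -> piece i' z -> (i' <= i)%N.
  move=> ii' [_ iz] [iz' _]; rewrite leqNgt; apply/negP => lti; apply: iz.
  rewrite ii'; apply: agree_le iz'.
  by move: (odd_double_half i) (odd_double_half i'); lia.
by apply/eqP; rewrite eqn_leq !le.
Qed.

Let piece_cover e n z : (m <= n)%N -> agree n (center e) z -> z <> center e ->
  exists k, [/\ odd k = e, (n <= m + k./2)%N & piece k z].
Proof.
move=> mn nz zc; have ex : exists n', `[< ~ agree n' (center e) z >].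
  by have [n' n'z] := agree_neq (nesym zc); exists n'; exact/asboolP.
case: (ex_minnP ex) => -[|j] /asboolP jz jmin; first by case: jz.
have nj : (n <= j)%N.
  by rewrite leqNgt; apply/negP => jn; apply: jz; exact: agree_le nz.
(* As [j.+1] is the least depth of disagreement, [z] lies in the piece whose index has parity [e]
   and half [j - m]. *)
have mE : (m + (e + (j - m).*2)./2)%N = j by rewrite half_bit_double; lia.
have oE : odd (e + (j - m).*2) = e by rewrite oddD odd_double addbF; case: (e).
exists (e + (j - m).*2)%N; rewrite mE oE; split=> //; split=> //; rewrite mE oE //.
by apply: contrapT => njz; have := jmin j (asboolT njz); rewrite ltnn.
Qed.

Section swap_of_copies.
Variables phi psi : nat -> C -> C.
Hypothesis copy : forall k, clopen_copy (piece k) (phi k) (psi k).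

(* A back-and-forth between the pieces: [phi k.+1] embeds [rest k] into the
   piece [k.+1], and [rest k.+1] is what this embedding misses. *)
Fixpoint rest (k : nat) : set C :=
  if k is k'.+1 then piece k'.+1 `\` (range (phi k'.+1) `&` psi k'.+1 @^-1` rest k')
  else piece 0.

Let rest_piece k : rest k `<=` piece k. Proof. by case: k => // k z []. Qed.

(** The image of [rest k] is the clopen range of [phi k.+1] cut by a preimage under the globally
    continuous [psi k.+1]. *)
Let clopen_rest k : clopen (rest k).
Proof.
elim: k => [|k IHk] /=; first exact: clopen_piece.
have [_ cpsi _ cr _] := copy k.+1.
apply: clopenD; first exact: clopen_piece.
by apply: clopenI => //; exact: preimage_clopen.
Qed.

Let phi_piece k z : rest k z -> (piece k.+1 `\` rest k.+1) (phi k.+1 z).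
Proof.
have [_ _ phiK _ rphi] := copy k.+1.
move=> kz; split; first by apply: rphi; exists z.
by move=> [_ +]; apply; split; [exists z|rewrite /= phiK].
Qed.

Let piece_psi k z : (piece k `\` rest k) z ->
  exists k', [/\ k = k'.+1, rest k' (psi k z) & phi k (psi k z) = z].
Proof.
case: k => [[]//|k [kz]]; have [_ _ phiK _ rphi] := copy k.+1.
move=> /not_andP[//|/contrapT[[y _ <-] /=]]; rewrite phiK => ky.
by exists k.
Qed.

(** Each piece splits into [rest k], sent forward to the next piece, and the remainder, sent back to
    the previous one; the two moves undo each other. Disjointness of the pieces makes the index
    picked by [cid] the only possible one. *)
Let swap_fun (z : C) : C :=
  if pselect (z = p) then b else if pselect (z = b) then p else
  if pselect (exists k, piece k z) is left kz then
    let k := projT1 (cid kz) in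
    if pselect (rest k z) then phi k.+1 z else psi k z
  else z.

Let piece_p k : ~ piece k p.
Proof.
move=> kp; have := center_sep (piece_center kp) (@agree_refl m (center false)).
by move: kp => [_ +] k0; rewrite k0; apply.
Qed.

Let piece_b k : ~ piece k b.
Proof.
move=> kp; have := center_sep (piece_center kp) (@agree_refl m (center true)).
by move: kp => [_ +] k0; rewrite k0; apply.
Qed.

Let swap_p : swap_fun p = b.
Proof. by rewrite /swap_fun; case: pselect. Qed.

Let swap_b : swap_fun b = p.
Proof.
by rewrite /swap_fun; case: pselect => bp //=; case: pselect.
Qed.

Let swap_rest k z : rest k z -> swap_fun z = phi k.+1 z.
Proof.
move=> rz; have kz := rest_piece rz; rewrite /swap_fun.
case: pselect => [zp|zp] /=; first by rewrite zp in kz; case: (piece_p kz).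
case: pselect => [zb|zb] /=; first by rewrite zb in kz; case: (piece_b kz).
case: pselect => [kz'|[]]; last by exists k.
by case: cid => j jz /=; rewrite (piece_disjoint jz kz); case: pselect.
Qed.

Let swap_unrest k z : (piece k `\` rest k) z -> swap_fun z = psi k z.
Proof.
move=> [kz rz]; rewrite /swap_fun.
case: pselect => [zp|zp] /=; first by rewrite zp in kz; case: (piece_p kz).
case: pselect => [zb|zb] /=; first by rewrite zb in kz; case: (piece_b kz).
case: pselect => [kz'|[]]; last by exists k.
by case: cid => j jz /=; rewrite (piece_disjoint jz kz); case: pselect.
Qed.

Let swap_out z : ~ agree m p z -> ~ agree m b z -> swap_fun z = z.
Proof.
move=> pz bz; rewrite /swap_fun.
case: pselect => [zp|zp] /=; first by rewrite zp in pz; case: pz.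
case: pselect => [zb|zb] /=; first by rewrite zb in bz; case: bz.
case: pselect => // h; case: (cid h) => k /= /piece_center.
by case: odd.
Qed.

Let swap_cases (P : C -> Prop) : P p -> P b -> (forall k z, piece k z -> P z) ->
  (forall z, ~ agree m p z -> ~ agree m b z -> P z) -> forall z, P z.
Proof.
move=> Pp Pb Pk Po z.
have [pz|pz] := pselect (agree m p z); last have [bz|bz] := pselect (agree m b z).
- have [->//|zp] := pselect (z = p).
  by have [k [_ _ /Pk]] := @piece_cover false m z (leqnn m) pz zp.
- have [->//|zb] := pselect (z = b).
  by have [k [_ _ /Pk]] := @piece_cover true m z (leqnn m) bz zb.
- exact: Po.
Qed.

Let swapK : involutive swap_fun.
Proof.
apply: swap_cases; rewrite ?swap_p ?swap_b//.
  move=> k z kz; have [rz|rz] := pselect (rest k z).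
    rewrite (swap_rest rz) (swap_unrest (phi_piece rz)).
    by have [_ _ ->] := copy k.+1.
  have [k' [kE rk' phipsi]] := piece_psi (conj kz rz).
  by rewrite (swap_unrest (conj kz rz)) (swap_rest rk') -kE.
by move=> z pz bz; rewrite !swap_out.
Qed.

(** Points move between consecutive pieces. That the index drops by at most one makes the images of
    points near one center approach the other. *)
Let swap_piece k z : piece k z ->
  exists k', [/\ odd k' = ~~ odd k, (k <= k'.+1)%N & piece k' (swap_fun z)].
Proof.
move=> kz; have [rz|rz] := pselect (rest k z).
  exists k.+1; rewrite (swap_rest rz); split => //.
    exact: leq_trans (leqnSn _) (leqnSn _).
  by have [] := phi_piece rz.
have [k' [kE rk' _]] := piece_psi (conj kz rz).
exists k'; split; [by rewrite kE /= negbK|by rewrite kE|].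
by rewrite (swap_unrest (conj kz rz)); exact: rest_piece.
Qed.

Let swap_center e : swap_fun (center e) = center (~~ e).
Proof. by case: e; [exact: swap_b|exact: swap_p]. Qed.

Let swap_continuous_center e : {for center e, continuous swap_fun}.
Proof.
(* [n.+1] rather than [n]: the index may drop by one, and its half with it. *)
apply/continuous_agreeP => n; exists (m + n.+1)%N => z ez.
have [->//|zc] := pselect (z = center e).
have [k [oke nk kz]] := piece_cover (leq_addr _ _) ez zc.
have [k' [oke' kk' k'z]] := swap_piece kz.
rewrite swap_center -oke -oke'; case: k'z => + _; apply: agree_le.
by move: (odd_double_half k) (odd_double_half k'); lia.
Qed.

Let continuous_local (f g : C -> C) (z : C) (V : set C) : open V -> V z ->
  {in V, f =1 g} -> continuous g -> {for z, continuous f}.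
Proof.
move=> oV Vz fg cg; apply: (cvg_trans _ (_ : g @ z --> f z)).
  apply: near_eq_cvg; apply: filterS (open_nbhs_nbhs (conj oV Vz)) => y Vy.
  by rewrite fg//; exact/mem_set.
by rewrite fg ?inE//; exact: cg.
Qed.

Let swap_continuous : continuous swap_fun.
Proof.
apply: swap_cases.
- exact: (swap_continuous_center (e := false)).
- exact: (swap_continuous_center (e := true)).
- move=> k z kz; have [rz|rz] := pselect (rest k z).
    have [cphi _ _ _ _] := copy k.+1.
    apply: (@continuous_local _ (phi k.+1) _ (rest k)) => //.
      by have [] := clopen_rest k.
    by move=> y /set_mem/swap_rest.
  have [_ cpsi _ _ _] := copy k.
  apply: (@continuous_local _ (psi k) _ (piece k `\` rest k)) => //.
    have [ok _] := clopen_piece k; have [_ cr] := clopen_rest k.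
    by apply: openI => //; rewrite openC.
  by move=> y /set_mem/swap_unrest.
- move=> z pz bz.
  apply: (@continuous_local _ id _ (~` agree m p `&` ~` agree m b)) => //.
    by apply: openI; rewrite openC; have [] := clopen_agree m p;
      have [] := clopen_agree m b.
    by move=> y /set_mem[]; exact: swap_out.
  by move=> ?; exact: cvg_id.
Qed.

(** [psi k] is applied only to points of the form [phi k y], so invariance under the [phi k]
    suffices. *)
Let swap_invariant (S : set C) : (forall k, phi k @^-1` S = S) -> S p -> S b ->
  swap_fun @^-1` S = S.
Proof.
move=> Sphi Sp Sb; have SphiE k z : S (phi k z) = S z by rewrite -{2}(Sphi k).
apply/funext; apply: swap_cases; rewrite /preimage/= ?swap_p ?swap_b.
- by rewrite !propeqE.
- by rewrite !propeqE.
- move=> k z kz; have [rz|rz] := pselect (rest k z).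
    by rewrite (swap_rest rz).
  have [k' [_ _ phipsi]] := piece_psi (conj kz rz).
  by rewrite (swap_unrest (conj kz rz)) -[in RHS]phipsi SphiE.
- by move=> z pz bz; rewrite swap_out.
Qed.

Lemma swap_of_copies : exists g : C -> C,
  [/\ involutive g, continuous g, g p = b,
      forall z, ~ agree m p z -> ~ agree m b z -> g z = z &
      forall S, (forall k, phi k @^-1` S = S) -> S p -> S b -> g @^-1` S = S].
Proof. by exists swap_fun. Qed.

End swap_of_copies.

Lemma exists_swap (Ss : set (set C)) : shrinkable Ss -> exists g : C -> C,
  [/\ involutive g, continuous g, g p = b,
      forall z, ~ agree m p z -> ~ agree m b z -> g z = z &
      forall S, Ss S -> S p -> S b -> g @^-1` S = S].
Proof.
move=> hS.
have h k : exists f : (C -> C) * (C -> C), clopen_copy (piece k) f.1 f.2 /\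
    forall S, Ss S -> f.1 @^-1` S = S.
  have [phi [psi h]] := hS _ (clopen_piece k).1 (piece_neq0 k).
  by exists (phi, psi).
have /choice[f fP] := h.
have [g [gK cg gp gout ginv]] := swap_of_copies (fun k => (fP k).1).
exists g; split=> // S hSS; apply: ginv => k.
by have [_ ->] := fP k.
Qed.

End swap.

(** * Correcting an automorphism at one point *)

Definition automorphism (Ss : set (set C)) (h k : C -> C) : Prop :=
  [/\ continuous h, continuous k, cancel h k, cancel k h &
      forall S, Ss S -> h @^-1` S = S].

Lemma automorphism_sym Ss h k : automorphism Ss h k -> automorphism Ss k h.
Proof.
move=> [ch ck hk kh hS]; split=> // S SS; rewrite -{1}(hS S SS).
by apply/funext => x; rewrite /preimage /= kh.
Qed.

(** The correction follows [h] by a swap of [h a] with a point of [B] so close to it that the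
    support of the swap is small. *)
Lemma automorphism_step Ss (E E' B : set C) n h k a :
  shrinkable Ss -> automorphism Ss h k -> closed E -> closed E' ->
  (forall S, Ss S -> S a) -> (forall S, Ss S -> B `<=` S) ->
  (forall m, exists2 b, B b & agree m (h a) b) ->
  ~ E a -> ~ E' (h a) ->
  exists h' k', [/\ automorphism Ss h' k', B (h' a),
    (forall x, agree n (h x) (h' x)) /\ (forall y, agree n (k y) (k' y)),
    {in E, h' =1 h} & {in E', k' =1 k}].
Proof.
move=> shr aut clE clE' SsA SsB denseB Ea E'a.
have [ch ck hk kh hS] := aut.
(* The preimage of [E] under [k] is the image of [E] under [h]: a swap supported off it and off [E']
   changes neither [h] on [E] nor [k] on [E']. *)
have /open_agreeP oF : open (~` (k @^-1` E `|` E')).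
  apply: closed_openC; apply: closedU => //.
  by apply: preimage_closed => // x _; exact: ck.
have [|m1 m1F] := oF (h a); first by case; rewrite /preimage/= ?hk.
have /continuous_agreeP /(_ n)[m2 m2k] := ck (h a).
(* Depth [n] keeps the new [h] close to the old one, [m1] avoids the protected sets, and [m2] keeps
   the new [k] close. *)
pose M := maxn n (maxn m1 m2).
have MF y : agree M (h a) y -> ~ E (k y) /\ ~ E' y.
  move=> hy; apply/not_orP; apply: m1F; apply: agree_le hy.
  by rewrite !leq_max leqnn orbT.
have Mk y : agree M (h a) y -> agree n a (k y).
  by rewrite -{2}(hk a) => ?; apply: m2k; apply: agree_le (_ : agree M _ _) => //;
    rewrite !leq_max leqnn !orbT.
have [b Bb hab] := denseB M.
have [bE|bha] := pselect (b = h a).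
  by exists h, k; split => //; rewrite -bE.
have [m0 m0P] := agree_neq (nesym bha).
pose m := maxn M m0.
have mP : ~ agree m (h a) b.
  by move=> /(agree_le (leq_maxr M m0)).
have [g [gK cg gp gout gS]] := exists_swap mP shr.
(* If the involution [g] moves [z], it moves [g z] too, so both lie in its support. *)
have loc z : g z = z \/ agree M (h a) z /\ agree M (h a) (g z).
  have moved y : g y <> y -> agree M (h a) y.
    move=> gy; have [|py] := pselect (agree m (h a) y).
      exact: agree_le (leq_maxl _ _).
    have [by_|by_] := pselect (agree m b y); last by case: gy; exact: gout.
    by apply: agree_trans hab _; apply: agree_le by_; exact: leq_maxl.
  have [|gz] := pselect (g z = z); [by left|right; split; apply: moved => //].
  by rewrite gK => /esym.
exists (g \o h), (k \o g); split.
- split=> [x|x|x|x|S SS].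
  + by apply: continuous_comp; [exact: ch|exact: cg].
  + by apply: continuous_comp; [exact: cg|exact: ck].
  + by rewrite /= gK hk.
  + by rewrite /= kh gK.
  + rewrite comp_preimage gS ?hS //; last exact: SsB Bb.
    by rewrite -[S (h a)]/((h @^-1` S) a) hS//; exact: SsA.
- by rewrite /= gp.
- split=> z /=.
    have [->//|[hz ghz]] := loc (h z).
    by apply: (@agree_le _ M); [exact: leq_maxl|exact: agree_trans (agree_sym hz) ghz].
  have [->//|[/Mk hz /Mk ghz]] := loc z.
  exact: agree_trans (agree_sym hz) ghz.
- move=> x /set_mem Ex /=; have [//|[/MF[]]] := loc (h x).
  by rewrite hk.
- move=> y /set_mem Ey /=; have [->//|[/MF[]]] := loc y.
  by [].
Qed.

(** * Limits of uniformly converging maps *)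

Lemma limit_agree (h : nat -> C -> C) :
  (forall n x, agree n (h n x) (h n.+1 x)) ->
  exists H : C -> C, forall n x, agree n (h n x) (H x).
Proof.
move=> hS; have hD j n x : agree n (h n x) (h (n + j)%N x).
  elim: j => [|j IHj]; first by rewrite addn0.
  apply: agree_trans IHj _; rewrite addnS.
  by apply: agree_le (hS _ _); exact: leq_addr.
(* Coordinate [i] no longer changes from stage [i.+1] on. *)
exists (fun x i => h i.+1 x i) => n x i lin.
by rewrite -(subnKC lin) -hD.
Qed.

Lemma limit_continuous (h : nat -> C -> C) (H : C -> C) :
  (forall n, continuous (h n)) -> (forall n x, agree n (h n x) (H x)) ->
  continuous H.
Proof.
move=> ch hH x; apply/continuous_agreeP => n.
have /continuous_agreeP/(_ n)[m mh] := ch n x; exists m => y /mh xy.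
by apply: agree_trans (hH n y); apply: agree_trans xy; exact/agree_sym/hH.
Qed.

Lemma limit_cancel (h k : nat -> C -> C) (H K : C -> C) :
  (forall n, continuous (k n)) -> (forall n, cancel (h n) (k n)) ->
  (forall n x, agree n (h n x) (H x)) -> (forall n x, agree n (k n x) (K x)) ->
  cancel H K.
Proof.
move=> ck hk hH kK x; apply: agree_eq => n.
have /continuous_agreeP/(_ n)[m mk] := ck n (H x).
pose M := maxn n m.
have HxM : agree M (H x) (h M x) by exact/agree_sym/hH.
(* To depth [n], each of [K (H x)], [k n (H x)], [k n (h M x)], [K (h M x)] and [k M (h M x) = x]
   agrees with the next. *)
apply: agree_trans (agree_sym (kK n _)) _.
apply: agree_trans (mk _ (agree_le (leq_maxr _ _) HxM)) _.
apply: agree_trans (kK n _) _; rewrite -{2}(hk M x).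
by apply: agree_sym; apply: agree_le (kK M _); exact: leq_maxl.
Qed.

Lemma limit_stationary (h : nat -> C -> C) (H : C -> C) n x :
  (forall m x, agree m (h m x) (H x)) ->
  (forall m, (n <= m)%N -> h m.+1 x = h m x) -> H x = h n x.
Proof.
move=> hH st; apply/esym/agree_eq => m.
have {}st j : h (n + j)%N x = h n x.
  by elim: j => [|j <-]; rewrite ?addn0// addnS st ?leq_addr.
by rewrite -(st m); apply: agree_le (hH _ _); exact: leq_addl.
Qed.

(** * The back-and-forth construction *)

Section back_and_forth.
Variables (Ss : set (set C)) (K : nat -> set C) (D : set C).
Hypotheses (shr : shrinkable Ss) (clK : forall n, closed (K n)).
Hypotheses (KS : forall n, K n `<=` K n.+1) (DK : forall n, D `&` K n = set0).
Hypotheses (SsD : Ss D) (DSs : forall S, Ss S -> D `<=` S).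

(** The point or its image may already be protected; the two implications ensure that no correction
    is called for in that case. *)
Let half_step (E E' B : set C) n h k a :
  automorphism Ss h k -> closed E -> closed E' -> B `<=` D -> D a ->
  (forall x, D x -> forall m, exists2 b, B b & agree m x b) ->
  (E a -> B (h a)) -> (E' (h a) -> B (h a)) ->
  exists h' k', [/\ automorphism Ss h' k', B (h' a),
    (forall x, agree n (h x) (h' x)) /\ (forall y, agree n (k y) (k' y)),
    {in E, h' =1 h} & {in E', k' =1 k}].
Proof.
move=> aut clE clE' BD Da denseB Ea E'a.
have [Bha|nBha] := pselect (B (h a)); first by exists h, k; split.
apply: automorphism_step => //.
- by move=> S /DSs; exact.
- by move=> S /DSs; exact: subset_trans.
- apply: denseB; have [_ _ _ _ hS] := aut.
  by rewrite -[D _]/((h @^-1` D) a) hS.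
- by move=> /Ea.
- by move=> /E'a.
Qed.

Variables a b : nat -> C.
Hypotheses (aD : range a `<=` D) (bD : range b `<=` D).
Hypothesis a_dense : forall x, D x -> forall m, exists2 y, range a y & agree m x y.
Hypothesis b_dense : forall x, D x -> forall m, exists2 y, range b y & agree m x y.

(* At stage [n], later maps keep their values on [frozen a n], and their inverses
   on [frozen b n]. *)
Let frozen (c : nat -> C) (n : nat) : set C := K n `|` c @` `I_n.

Let closed_frozen c n : closed (frozen c n).
Proof.
apply: closedU => //.
have /accessible_finite_set_closed := hausdorff_accessible cantor_space_hausdorff.
by apply; exact/finite_image/finite_II.
Qed.

Let stage n (p : (C -> C) * (C -> C)) : Prop := automorphism Ss p.1 p.2 /\
  forall i, (i < n)%N -> range b (p.1 (a i)) /\ range a (p.2 (b i)).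

Let step n (p q : (C -> C) * (C -> C)) : Prop :=
  [/\ forall x, agree n (p.1 x) (q.1 x), forall y, agree n (p.2 y) (q.2 y),
      {in frozen a n, q.1 =1 p.1} & {in frozen b n, q.2 =1 p.2}].

(** Forth for [a n], then back for [b n] by the same half step on the inverse pair. As [D] misses
    [K n], a point of [D] is frozen only as an earlier term of [a] or [b], and then the required
    matching already holds. *)
Let stage_step n p : stage n p -> exists q, stage n.+1 q /\ step n p q.
Proof.
case: p => h k [/= aut hst].
have autD h' k' x : automorphism Ss h' k' -> D x -> D (h' x).
  by move=> [_ _ _ _ hS] Dx; rewrite -[D _]/((h' @^-1` D) x) hS.
have DKn x j : D x -> K j x -> False.
  by move=> Dx Kx; have : (D `&` K j) x by []; rewrite DK.
have Da i : D (a i) by apply: aD; exists i.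
have Db i : D (b i) by apply: bD; exists i.
have [||h1 [k1 [aut1 h1a [ah1 ak1] h1E k1E]]] := half_step n aut
  (@closed_frozen a n) (@closed_frozen b n) bD (Da n) b_dense.
- by move=> [/(DKn _ _ (Da n))//|[i /hst[+ _] <-]].
- by move=> [/(DKn _ _ (autD _ _ _ aut (Da n)))//|[i _ <-]]; exists i.
have aut1' := automorphism_sym aut1.
have fI (c : nat -> C) i j : (i < j)%N -> c i \in frozen c j.
  by move=> ij; apply/mem_set; right; exists i.
(* [n.+1] on the side of [a] protects the value just given to [a n]. *)
have [||k2 [h2 [aut2 k2b [ak2 ah2] k2E h2E]]] := half_step n aut1'
  (@closed_frozen b n) (@closed_frozen a n.+1) aD (Db n) a_dense.
- move=> [/(DKn _ _ (Db n))//|[i lin ibn]]; rewrite -ibn k1E ?fI//.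
  by have [] := hst i lin.
- by move=> [/(DKn _ _ (autD _ _ _ aut1' (Db n)))//|[i _ <-]]; exists i.
exists (h2, k2); split; split=> /=.
- exact: automorphism_sym.
- move=> i; rewrite ltnS leq_eqVlt => /predU1P[->|lin].
    by split => //; rewrite h2E ?fI.
  have [ha kb] := hst _ lin; split.
    by rewrite h2E ?fI ?h1E ?fI// ltnW.
  by rewrite k2E ?fI// k1E ?fI.
- by move=> x; exact: agree_trans (ah1 x) (ah2 x).
- by move=> x; exact: agree_trans (ak1 x) (ak2 x).
- move=> x xE; rewrite h2E ?h1E//; apply/mem_set; case/set_mem: xE => [/KS|].
    by left.
  by move=> [i lin <-]; right; exists i => //=; exact: ltnW.
- by move=> x xE; rewrite k2E ?k1E.
Qed.

(** Invariance does not simply pass to the limit, hence [set0]; it is recovered for sets whose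
    complement is covered by the [K n], on which the limit coincides with a stage. *)
Lemma back_and_forth : exists h k, [/\ automorphism set0 h k,
  forall i, range b (h (a i)), forall i, range a (k (b i)) &
  forall S, Ss S -> ~` S `<=` \bigcup_n K n -> h @^-1` S = S].
Proof.
(* Putting the implication under the existential makes [f] total, so plain recursion yields the
   stages. *)
have /choice[f fP] : forall np : nat * ((C -> C) * (C -> C)), exists q,
    stage np.1 np.2 -> stage np.1.+1 q /\ step np.1 np.2 q.
  move=> [n p]; have [/stage_step[q ?]|?] := pselect (stage n p); first by exists q.
  by exists p.
pose s := fix s n := if n is n'.+1 then f (n', s n') else (id, id).
have sP n : stage n (s n).
  elim: n => [|n IHn]; last by have [] := fP (n, s n) IHn.
  by split=> //; split=> //= x; exact: cvg_id.
have sS n : step n (s n) (s n.+1) by have [] := fP (n, s n) (sP n).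
have [h hP] : exists h, forall n x, agree n ((s n).1 x) (h x).
  by apply: limit_agree => n; have [] := sS n.
have [k kP] : exists k, forall n x, agree n ((s n).2 x) (k x).
  by apply: limit_agree => n; have [] := sS n.
have frozen_le (c : nat -> C) m n : (m <= n)%N -> frozen c m `<=` frozen c n.
  move=> mn x [xK|[i im <-]]; last by right; exists i => //=; exact: leq_trans mn.
  left; elim: n mn => [|n IHn]; first by rewrite leqn0 => /eqP <-.
  by rewrite leq_eqVlt => /predU1P[<-//|/IHn/KS].
have hE n x : frozen a n x -> h x = (s n).1 x.
  move=> xn; apply: (limit_stationary (h := fun n => (s n).1)) => // m nm.
  by have [_ _ -> //] := sS m; apply/mem_set/(frozen_le _ _ _ nm).
have kE n x : frozen b n x -> k x = (s n).2 x.
  move=> xn; apply: (limit_stationary (h := fun n => (s n).2)) => // m nm.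
  by have [_ _ _ -> //] := sS m; apply/mem_set/(frozen_le _ _ _ nm).
have chk : automorphism set0 h k.
  split=> //.
  - by apply: limit_continuous hP => n; have [[]] := sP n.
  - by apply: limit_continuous kP => n; have [[]] := sP n.
  - by apply: limit_cancel hP kP => n; have [[]] := sP n.
  - by apply: limit_cancel kP hP => n; have [[]] := sP n.
exists h, k; split=> //.
- move=> i; rewrite (hE i.+1); last by right; exists i => /=.
  by have [_ /(_ i (ltnSn i))[]] := sP i.+1.
- move=> i; rewrite (kE i.+1); last by right; exists i => /=.
  by have [_ /(_ i (ltnSn i))[]] := sP i.+1.
move=> S SS SK; have [_ _ hk kh _] := chk.
have hSn n x : S ((s n).1 x) = S x.
  have [[_ _ _ _ hS] _] := sP n.
  by rewrite -[LHS]/(((s n).1 @^-1` S) x) hS.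
have kSn n x : S ((s n).2 x) = S x.
  have [/automorphism_sym[_ _ _ _ hS] _] := sP n.
  by rewrite -[LHS]/(((s n).2 @^-1` S) x) hS.
(* A point outside [S] is followed by [h] for one inclusion and by [k] for the other; on [K n] each
   equals its map at stage [n], which preserves [S]. *)
rewrite eqEsubset; split=> x; apply: contraPP => Sx.
  by have [n _ xK] := SK _ Sx; rewrite /preimage/= (hE n) ?hSn//; left.
by have [n _ xK] := SK _ Sx; rewrite -[x in S x](hk x) (kE n) ?kSn//; left.
Qed.

End back_and_forth.

(** * Polish subspaces of the Cantor set *)

Lemma nbhs_set_type (T : topologicalType) (Y : set T) (x : Y) (A : set Y) :
  nbhs x A <-> exists2 V, nbhs (set_val x) V & set_val @^-1` V `<=` A.
Proof.
split=> [[_ [[W oW <-] Wx WA]]|[V]].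
  by exists W => //; exact: open_nbhs_nbhs.
rewrite nbhsE => -[W [oW Wx] WV] VA.
by exists (set_val @^-1` W); split => [|//|y /WV/VA//]; exists W.
Qed.

(** A completely metrizable subspace is a G-delta, here expressed by closed complements. The map [i]
    stands for an inclusion, to allow a subspace of a subspace. *)
Lemma polish_Gdelta (R : realType) (T : topologicalType) (i : T -> C) :
  (forall t A, nbhs t A <-> exists n, [set t' | agree n (i t) (i t')] `<=` A) ->
  polish R T ->
  exists K : nat -> set C, [/\ forall n, closed (K n),
    forall n, K n `<=` K n.+1 & \bigcup_n K n = ~` range i].
Proof.
move=> nbhsT [_ [d [[d0 dE dC dD] dT dlim]]].
(* [O n] consists of the points near which the metric oscillates by less than
   [1 / n.+1]; requiring [n <= m] makes [O] decreasing. *)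
pose O n := [set z : C | exists m, [/\ (n <= m)%N,
  exists t, agree m z (i t) &
  forall t t', agree m z (i t) -> agree m z (i t') -> (d t t' < n.+1%:R^-1)%R]].
have oO n : open (O n).
  apply/open_agreeP => z [m [nm [t zt] tt]]; exists m => y zy.
  exists m; split=> // [|t1 t2 yt1 yt2].
    by exists t; exact: agree_trans (agree_sym zy) zt.
  by apply: tt; exact: agree_trans zy _.
exists (fun n => ~` O n); split.
- by move=> n; exact: open_closedC.
- move=> n z; apply: contra_not => -[m [nm zt tt]].
  exists m; split=> // [|t t' zt1 zt2]; first exact: ltnW.
  by apply: lt_trans (tt _ _ zt1 zt2) _; rewrite ltf_pV2 ?posrE ?ltr0n// ltr_nat.
rewrite -setC_bigcap; congr (~` _); rewrite eqEsubset; split=> [z zO|_ [t _ <-] n _].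
- have /choice[m mP] : forall n, exists m, [/\ (n <= m)%N,
    exists t, agree m z (i t) &
    forall t t', agree m z (i t) -> agree m z (i t') -> (d t t' < n.+1%:R^-1)%R].
    by move=> n; exact: zO.
  (* The images of the [u n] converge to [z], and the small oscillation makes [u] Cauchy; its limit
     [l] then satisfies [i l = z]. *)
  have /choice[u uP] : forall n, exists t, agree (m n) z (i t).
    by move=> n; have [] := mP n.
  have ule N n : (N <= n)%N -> agree N z (i (u n)).
    by move=> Nn; apply: agree_le (uP n); apply: leq_trans Nn _; have [] := mP n.
  have [|l ul] := dlim u.
    move=> e e0.
    have [N Ne] : exists N : nat, (N.+1%:R^-1 < e)%R.
      by have [N _ /(_ N (leqnn N))] := near_infty_natSinv_lt (PosNum e0); exists N.
    exists (m N) => j k mj mk; apply: lt_trans Ne.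
    by have [_ _] := mP N; apply; exact: ule.
  exists l => //; apply/esym/agree_eq => n.
  have /ul[N _ Nl] : nbhs l [set t' | agree n (i l) (i t')] by apply/nbhsT; exists n.
  apply: agree_trans (ule n (maxn n N) (leq_maxl _ _)) _.
  by apply: agree_sym; apply: Nl; rewrite /= leq_maxr.
(* Half the bound, because two points near [t] are compared through [t]. *)
- pose e := (n.+1%:R^-1 / 2 : R)%R.
  have e0 : (0 < e)%R by rewrite divr_gt0// invr_gt0 ltr0n.
  have /nbhsT[m mt] : nbhs t [set t' | (d t t' < e)%R] by apply/dT; exists e.
  exists (maxn n m); split; [exact: leq_maxl|by exists t|].
  have {}mt t' : agree (maxn n m) (i t) (i t') -> (d t t' < e)%R.
    by move=> tt'; apply: mt; apply: agree_le tt'; exact: leq_maxr.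
  move=> t1 t2 /mt tt1 /mt tt2; apply: le_lt_trans (dD t1 t t2) _.
  by rewrite dC [ltRHS]splitr ltrD.
Qed.

(** * Copies given by the homogeneous embedding, and a countable invariant set *)

Lemma homogeneous_copy (X V : set C) : h_homogeneously_embedded X ->
  open V -> V !=set0 -> exists phi psi,
    [/\ clopen_copy V phi psi, phi @^-1` X = X & X `<=` psi @^-1` X].
Proof.
move=> [B [[Bopen Bbase] Bclopen Bphi]] oV V0.
have [U BU UV] := Bbase V oV V0.
have [oU clU] := Bclopen U BU.
have [f [[g [fK gK cf cg]] fX]] := Bphi U BU.
pose phi x : C := set_val (f x).
(* Extension by the identity off [U] is continuous because [U] is clopen, and it still sends [X]
   into [X]. *)
pose psi z : C := if pselect (U z) is left Uz then g (exist _ z (mem_set Uz)) else z.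
have Uphi x : U (phi x) by exact: set_valP.
have phiK : cancel phi psi.
  move=> x; rewrite /psi; case: pselect => // Ux.
  by rewrite -[RHS]fK; congr g; exact: val_inj.
have psiK z : U z -> phi (psi z) = z.
  by move=> Uz; rewrite /psi; case: pselect => // Uz'; rewrite /phi gK.
have phiU : range phi = U.
  rewrite eqEsubset; split=> [_ [x _ <-]//|z Uz].
  by exists (psi z) => //; exact: psiK.
have phiX : phi @^-1` X = X.
  rewrite eqEsubset; split=> x; rewrite /preimage/= => Xx.
    have : (X `&` U) (phi x) by [].
    by rewrite -fX => -[y Xy] /(can_inj phiK) <-.
  by have [] : (X `&` U) (phi x) by rewrite -fX; exists x.
exists phi, psi; split=> //; first split=> //.
- move=> x; apply: (@continuous_comp _ _ _ f set_val x); first exact: cf.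
  exact: initial_continuous.
- move=> z A; have [Uz|Uz] := pselect (U z).
    rewrite {1}/psi; case: pselect => // Uz' /cg /nbhs_set_type[W /= zW WA].
    apply: filterS (filterI zW (open_nbhs_nbhs (conj oU Uz))) => y [Wy Uy].
    by rewrite /preimage/= /psi; case: pselect => // Uy'; exact: WA.
  rewrite {1}/psi; case: pselect => // _ zA.
  have oUC : open (~` U) by rewrite openC.
  apply: filterS (filterI zA (open_nbhs_nbhs (conj oUC Uz))) => y [Ay Uy].
  by rewrite /preimage/= /psi; case: pselect.
- by rewrite phiU.
- by rewrite phiU.
move=> z Xz; have [Uz|Uz] := pselect (U z).
  by rewrite -phiX /preimage/= psiK.
by rewrite /preimage/= /psi; case: pselect.
Qed.

Lemma clopen_copy_subset V W phi psi :
  V `<=` W -> clopen_copy V phi psi -> clopen_copy W phi psi.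
Proof. by move=> VW [? ? ? ? rV]; split=> //; exact: subset_trans VW. Qed.

(** Cylinders form a countable base, so one copy inside each suffices; [D] is the orbit of [A] under
    words in these embeddings and their left inverses. *)
Lemma countable_invariant_hull (X A : set C) : h_homogeneously_embedded X ->
  A `<=` X -> countable A -> exists D,
    [/\ countable D, A `<=` D, D `<=` X & shrinkable [set X; D]].
Proof.
move=> hX AX cA.
pose cylinder (s : seq bool) := agree (size s) (nth false s : C).
have /choice[f fP] : forall s, exists f : (C -> C) * (C -> C),
    [/\ clopen_copy (cylinder s) f.1 f.2, f.1 @^-1` X = X & X `<=` f.2 @^-1` X].
  move=> s; have [||phi [psi ?]] := @homogeneous_copy X (cylinder s) hX.
  - by have [] := clopen_agree (size s) (nth false s : C).
  - by exists (nth false s).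
  - by exists (phi, psi).
pose act (e : seq bool * bool) := if e.2 then (f e.1).1 else (f e.1).2.
pose D := \bigcup_(w in [set: seq (seq bool * bool)]) (foldr act ^~ w) @` A.
have actD e x : D x -> D (act e x).
  by move=> [w _ [y Ay <-]]; exists (e :: w) => //; exists y.
exists D; split.
- apply: bigcup_countable => // w _.
  exact: (sub_countable (card_image_le _ _)).
- by move=> x Ax; exists [::] => //; exists x.
- move=> _ [w _ [x Ax <-]]; elim: w => [|[s []] w IHw] /=; first exact: AX.
    have [_ fX _] := fP s.
    by rewrite /act /= -[X _]/(((f s).1 @^-1` X) (foldr act x w)) fX.
  by have [_ _] := fP s; apply.
move=> V /open_agreeP oV [x Vx]; have [n nV] := oV x Vx.
pose s := mkseq x n; have [fcopy fX _] := fP s.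
exists (f s).1, (f s).2; split.
  apply: clopen_copy_subset fcopy; apply: subset_trans nV => y.
  rewrite /cylinder size_mkseq => sy i lin.
  by rewrite -(sy i lin) nth_mkseq.
move=> S [->//|->]; have [_ _ fK _ _] := fcopy.
rewrite eqEsubset; split=> z; last exact: (actD (s, true)).
(* If the image of [z] lies in [D], the left inverse brings [z] back into [D]. *)
by move=> /(actD (s, false)); rewrite /act /= fK.
Qed.

(** * Passage to the subspace [X] and conclusion *)

Lemma countable_range (T : Type) (A : set T) :
  countable A -> A !=set0 -> exists a : nat -> T, range a = A.
Proof.
move=> /pfcard_geP[->[x []]//|[a] _]; exists a.
by rewrite image_eq.
Qed.

Lemma set_type_automorphism (X : set C) h k : automorphism [set X] h k ->
  exists f : X -> X, homeomorphism f /\ forall x, set_val (f x) = h (set_val x).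
Proof.
move=> aut; have [ch ck hk kh hX] := aut.
have [_ _ _ _ kX] := automorphism_sym aut.
have hX' (x : X) : X (h (set_val x)).
  by rewrite -[X _]/((h @^-1` X) (set_val x)) hX//; exact: set_valP.
have kX' (x : X) : X (k (set_val x)).
  by rewrite -[X _]/((k @^-1` X) (set_val x)) kX//; exact: set_valP.
pose f (x : X) : X := exist _ (h (set_val x)) (mem_set (hX' x)).
pose g (x : X) : X := exist _ (k (set_val x)) (mem_set (kX' x)).
have cval (u : C -> C) (v : X -> X) : continuous u ->
    (forall x, set_val (v x) = u (set_val x)) -> continuous v.
  move=> cu uv x A /nbhs_set_type[V]; rewrite uv => /cu uV VA.
  apply/nbhs_set_type; exists (u @^-1` V) => // y Vy.
  by apply: VA; rewrite /preimage/= uv.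
exists f; split=> //; exists g; split.
- by move=> x; apply: val_inj; exact: hk.
- by move=> x; apply: val_inj; exact: kh.
- exact: (cval h).
- exact: (cval k).
Qed.

Lemma dense_set_type_agree (X : set C) (A : set X) : dense A ->
  forall x, X x -> forall m, exists2 y, (set_val @` A) y & agree m x y.
Proof.
move=> dA x Xx m; pose x' : X := exist _ x (mem_set Xx).
have [||y [xy Ay]] := dA (set_val @^-1` agree m x).
- by exists x'.
- by exists (agree m x) => //; have [] := clopen_agree m x.
by exists (set_val y) => //; exists y.
Qed.

Lemma nbhs_set_type_agree (X : set C) (Y : set X) (y : Y) (A : set Y) :
  nbhs y A <-> exists n,
    [set y' | agree n (set_val (set_val y)) (set_val (set_val y'))] `<=` A.
Proof.
split=> [/nbhs_set_type[V /nbhs_set_type[W /nbhs_agreeP[n nW] WV] VA]|[n nA]].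
  by exists n => y' yy'; apply: VA; apply: WV; exact: nW.
apply/nbhs_set_type; exists (set_val @^-1` agree n (set_val (set_val y))) => //.
by apply/nbhs_set_type; exists (agree n (set_val (set_val y))) => //; exact: nbhs_agree.
Qed.

Theorem theorem7p3 (R : realType) (X : set cantor_space)
    (hX : h_homogeneously_embedded X)
    (cX : countably_controlled R X) :
  countable_dense_homogeneous X.
Proof.
move=> A B cA dA cB dB.
(* The empty case is separate, since [A] and [B] are enumerated by all of [nat], possibly with
   repetitions. *)
have [[x0 Xx0]|X0] := pselect (X !=set0); last first.
  have noX (x : X) : False by apply: X0; exists (set_val x); exact: set_valP.
  exists id; split; last by apply/funext => x; case: (noX x).
  by exists id; split=> // x; case: (noX x).
have neX (E : set X) : dense E -> E !=set0.
  move=> dE; have [||x [_ Ex]] := dE setT; last by exists x.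
    by exists (exist _ x0 (mem_set Xx0)).
  exact: openT.
have [a aA] := countable_range cA (neX _ dA).
have [b bB] := countable_range cB (neX _ dB).
have [||D [cD ABD DX shr]] := @countable_invariant_hull X (set_val @` (A `|` B)) hX.
- by move=> _ [x _ <-]; exact: set_valP.
- apply: (sub_countable (card_image_le _ _)); rewrite -bigcup2E.
  by apply: bigcup_countable => // -[|[|]].
have [G [polG DG]] : exists G : set X, polish R G /\ set_val @^-1` D `<=` G.
  apply: cX; have /countable_injP[u uinj] := cD.
  apply/countable_injP; exists (u \o set_val) => x y /set_mem Dx /set_mem Dy /=.
  by move=> /uinj xy; apply: val_inj; apply: xy; exact/mem_set.
have [K [clK KS KG]] := polish_Gdelta (@nbhs_set_type_agree X G) polG.
have DK n : D `&` K n = set0.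
  rewrite -subset0 => x [Dx Kx].
  have : (~` range (fun y : G => set_val (set_val y))) x by rewrite -KG; exists n.
  apply; pose y : X := exist _ x (mem_set (DX _ Dx)).
  have Gy : G y by exact: DG.
  by exists (exist _ y (mem_set Gy)).
have [||||||h [k [[ch ck hk kh _] ha kb hS]]] :=
  @back_and_forth [set X; D] K D shr clK KS DK _ _ (set_val \o a) (set_val \o b).
- by right.
- by move=> S [->|->].
- by move=> _ [i _ <-]; apply: ABD; exists (a i) => //; left; rewrite -aA; exists i.
- by move=> _ [i _ <-]; apply: ABD; exists (b i) => //; right; rewrite -bB; exists i.
- move=> x Dx m; have [_ [y Ay <-] xy] := dense_set_type_agree dA (DX _ Dx) m.
  by exists (set_val y) => //; move: Ay; rewrite -aA => -[i _ <-]; exists i.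
- move=> x Dx m; have [_ [y By <-] xy] := dense_set_type_agree dB (DX _ Dx) m.
  by exists (set_val y) => //; move: By; rewrite -bB => -[i _ <-]; exists i.
(* As [G] lies in [X], the [K n] cover the complement of [X], so [h] preserves [X]. *)
have [|f [hf fE]] := @set_type_automorphism X h k.
  split=> // _ ->; apply: hS; first by left.
  rewrite KG; apply: subsetC => _ [y _ <-]; exact: set_valP.
exists f; split=> //; rewrite eqEsubset; split=> x.
- rewrite -aA -bB => -[_ [i _ <-] <-].
  have [j _ bj] := ha i; exists j => //; apply: val_inj.
  exact: etrans bj (esym (fE _)).
- rewrite -aA -bB => -[i _ <-]; have [j _ aj] := kb i.
  exists (a j); first by exists j.
  apply: val_inj; apply: etrans (fE _) _.
  by rewrite -[RHS](kh (set_val (b i))); congr h.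
Qed.
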